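(* Let $U$ be a finite ground set with $|U|=n$, let $g:2^U\to\mathbb{R}_{\geq0}$ be nonnegative, monotone and submodular, let $c$ be a nonnegative modular cost function on $U$, let $\kappa$ be a budget and $\epsilon\in(0,1)$. Then the algorithm \texttt{distorted-bi} (described in the context) makes $O(n\kappa\ln(1/\epsilon))$ queries of $f=g-c$ and produces a set $S$ with $|S|\leq\ln(1/\epsilon)\kappa$ such that for all $X\subseteq U$ with $|X|\leq\kappa$, $$g(S)-c(S)\geq(1-\epsilon)g(X)-\ln(1/\epsilon)c(X).$$
   Context: A set function $h$ is submodular if $h(A\cup\{x\})-h(A)\geq h(B\cup\{x\})-h(B)$ for $A\subseteq B\subseteq U$, $x\notin B$, and monotone if $h(A)\leq h(B)$ for $A\subseteq B$. $c$ is nonnegative modular: $c(X)=\sum_{x\in X}c_x$ with $c_x\geq0$. Let $t=\ln(1/\epsilon)\kappa$ and for each $i$ define $\Phi_i(X)=\left(1-\frac{1}{\kappa}\right)^{t-i}g(X)-c(X)$, with $\Delta\Phi_i(S,x)=\Phi_i(S\cup\{x\})-\Phi_i(S)$. Algorithm \texttt{distorted-bi}(input $\epsilon$): set $S\gets\emptyset$, $i\gets1$. While $|S|<\ln(1/\epsilon)\kappa$: let $u=\arg\max_{x\in U}\Delta\Phi_i(S,x)$; if $\Delta\Phi_i(S,u)>0$ then $S\gets S\cup\{u\}$ and $i\gets i+1$; otherwise stop the loop. Return $S$.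
   Formalization: The algorithm is corrected: a round with no positive gain leaves S unchanged and i still advances, for rounds i = 1..t, instead of stopping the loop (the guarantee fails if it stops); also t = ln(1/ε)κ is assumed to be an integer, since otherwise |S| ≤ t can fail. *)

(* Defs.v *)
From mathcomp Require Import all_boot all_order all_algebra.
From mathcomp Require Import reals.

Set Implicit Arguments.
Unset Strict Implicit.
Unset Printing Implicit Defensive.

Import Order.TTheory GRing.Theory Num.Theory.
Local Open Scope ring_scope.

Section SetFunctions.
Variables (R : realType) (U : finType).

Definition monotone_setfun (h : {set U} -> R) : Prop :=
  forall A B : {set U}, A \subset B -> h A <= h B.

Definition submodular (h : {set U} -> R) : Prop :=
  forall (A B : {set U}) (x : U), A \subset B -> x \notin B ->
    h (x |: A) - h A >= h (x |: B) - h B.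

Definition modular_cost (c : U -> R) (X : {set U}) : R := \sum_(x in X) c x.

End SetFunctions.

(* Programs with oracle access.  The oracle is not an argument of a program:
   it is reached only through [Query], so the counter of [exec] counts every
   access. *)
Section OraclePrograms.
Variables Q V : Type.

Inductive prog (A : Type) : Type :=
| Ret of A
| Query of Q & (V -> prog A).

Fixpoint bind (A B : Type) (p : prog A) (k : A -> prog B) : prog B :=
  match p with
  | Ret a => k a
  | Query q r => Query q (fun v => bind (r v) k)
  end.

(* Result of a program, and number of queries made. *)
Fixpoint exec (A : Type) (O : Q -> V) (p : prog A) : A * nat :=
  match p with
  | Ret a => (a, 0%N)
  | Query q r => let: (a, m) := exec O (r (O q)) in (a, m.+1)
  end.

End OraclePrograms.

Section DistortedBi.
Variables (R : realType) (U : finType) (kappa t : nat).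

(* A query of f = g - c at X is answered by its two components (g X, c X),
   since Phi_i weighs them differently. *)
Definition value_oracle (g : {set U} -> R) (c : U -> R) (X : {set U}) : R * R :=
  (g X, modular_cost c X).

Local Notation oprog := (prog {set U} (R * R)).

(* Phi_i(X), as a function of v = (g X, c X).  The subtraction t - i is only
   used with 1 <= i <= t. *)
Definition Phi (i : nat) (v : R * R) : R :=
  (1 - kappa%:R^-1) ^+ (t - i) * v.1 - v.2.

Definition query_DeltaPhi (i : nat) (S : {set U}) (x : U) : oprog R :=
  Query (x |: S) (fun v1 => Query S (fun v0 => Ret _ _ (Phi i v1 - Phi i v0))).

Fixpoint tabulate (s : seq U) (F : U -> oprog R) (d : {ffun U -> R}) :
    oprog {ffun U -> R} :=
  if s is x :: s' then
    bind (F x) (fun v => tabulate s' F [ffun y => if y == x then v else d y])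
  else Ret _ _ d.

Definition query_gains (i : nat) (S : {set U}) : oprog {ffun U -> R} :=
  tabulate (enum U) (query_DeltaPhi i S) [ffun=> 0].

(* An arbitrary tie-breaking rule for arg max, possibly different in each
   round i. *)
Definition argmax_rule (sel : nat -> {ffun U -> R} -> U) : Prop :=
  forall (i : nat) (d : {ffun U -> R}) (x : U), d x <= d (sel i d).

(* [m] rounds, numbered i, i+1, ..., starting from the set S.

   A round in which no element has a positive gain leaves S unchanged and the
   next round is run.  Leaving the loop at such a round would be wrong: the
   weight of g in Phi_i increases with i, so that positive gains may reappear,
   and the approximation guarantee fails.  For instance, with U = {x},
   g({x}) = 1, g(set0) = 0, c({x}) = 1/2, kappa = t = 2 and eps = exp(-1), the
   gain of x is 0 at i = 1, and S = set0 has value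
   0 < 1/2 - eps = (1 - eps) g({x}) - ln(1/eps) c({x}).
   The two versions agree on all executions where every round has a positive
   gain.  As #|S| < i throughout, the bound i <= t on rounds entails the loop
   condition #|S| < t. *)
Fixpoint distorted_bi_loop (sel : nat -> {ffun U -> R} -> U)
    (m i : nat) (S : {set U}) : oprog {set U} :=
  if m is m'.+1 then
    bind (query_gains i S) (fun d =>
      let u := sel i d in
      distorted_bi_loop sel m' i.+1 (if 0 < d u then u |: S else S))
  else Ret _ _ S.

Definition distorted_bi (sel : nat -> {ffun U -> R} -> U) : oprog {set U} :=
  distorted_bi_loop sel t 1 set0.

End DistortedBi.

(* Main.v *)
(** Let [a = 1 - 1/kappa].  Submodularity and monotonicity bound the best gain
    of round [i] below by [(a^(t-i) (g X - g S) - c X) / kappa] for every [X] of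
    size at most [kappa].  Adding the change of weight [a^(t-i) - a^(t-i+1) =
    a^(t-i) / kappa] applied to [g S], the potential [a^(t-i) g S - c S] grows
    by at least [(a^(t-i) g X - c X) / kappa] in round [i].  Over the [t] rounds
    these bounds add up to [(1 - a^t) g X - (t/kappa) c X], and
    [a^t <= exp (- t/kappa) = eps]. *)

Require Import Defs.
From mathcomp Require Import all_boot all_order all_algebra.
From mathcomp Require Import reals sequences exp.
From mathcomp Require Import lra.

Import Order.TTheory GRing.Theory Num.Theory.
Local Open Scope ring_scope.

Lemma exec_bind (Q V A B : Type) (O : Q -> V) (p : prog Q V A)
    (k : A -> prog Q V B) :
  exec O (bind p k) =
  ((exec O (k (exec O p).1)).1,
   ((exec O p).2 + (exec O (k (exec O p).1)).2)%N).
Proof.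
elim: p => [a|q r IH] /=; first by case: exec.
by rewrite IH; case: (exec O (r (O q))).
Qed.

Section Tabulation.
Variables (R : realType) (U : finType) (O : {set U} -> R * R).
Variable F : U -> prog {set U} (R * R) R.

Lemma exec_tabulate_queries (k : nat) (s : seq U) (d : {ffun U -> R}) :
  (forall x, (exec O (F x)).2 = k) ->
  (exec O (tabulate s F d)).2 = (size s * k)%N.
Proof. by move=> Fk; elim: s d => // x s IH d; rewrite /= exec_bind /= IH Fk. Qed.

Lemma exec_tabulate (s : seq U) (d : {ffun U -> R}) (x : U) :
  (exec O (tabulate s F d)).1 x =
  if x \in s then (exec O (F x)).1 else d x.
Proof.
elim: s d => // y s IH d; rewrite /= exec_bind /= IH ffunE inE.
by case: (x \in s); rewrite ?orbT ?orbF //; case: eqVneq => // ->.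
Qed.

End Tabulation.

Section SubmodularGains.
Variables (R : realType) (U : finType).
Implicit Types (S X : {set U}) (x : U).

Lemma modular_cost_setU1 (c : U -> R) S x : 0 <= c x ->
  modular_cost c (x |: S) <= c x + modular_cost c S.
Proof.
move=> cx; rewrite /modular_cost; have [xS|xS] := boolP (x \in S).
  by rewrite (setUidPr _) ?sub1set // lerDr.
by rewrite big_setU1.
Qed.

(** Monotonicity gives [g X <= g (S :|: X)]. Adding the elements of [X] to [S] one at a time then
    telescopes, and by submodularity each increment is at most the gain of that element at [S]
    itself. *)
Lemma submodular_sum_gains (g : {set U} -> R) S X :
  monotone_setfun g -> submodular g ->
  g X - g S <= \sum_(x in X) (g (x |: S) - g S).
Proof.
move=> g_mono g_sub.
suff gains (s : seq U) :
    g (S :|: [set x in s]) - g S <= \sum_(x <- s) (g (x |: S) - g S).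
  apply: le_trans (_ : g (S :|: X) - g S <= _).
    by rewrite lerB // g_mono // subsetUr.
  rewrite -big_enum; have := gains (enum X).
  by rewrite (_ : [set x in enum X] = X) //; apply/setP=> x; rewrite inE mem_enum.
elim: s => [|x s IH].
  have -> : S :|: [set x in [::]] = S by apply/setP=> x; rewrite !inE orbF.
  by rewrite big_nil subrr.
have -> : S :|: [set y in x :: s] = x |: (S :|: [set y in s]).
  by apply/setP=> y; rewrite !inE orbCA.
rewrite big_cons.
set T := S :|: _ in IH *.
suff : g (x |: T) - g T <= g (x |: S) - g S by lra.
(* Submodularity covers only [x \notin T]. Since [s] may repeat elements or meet [S], the other case
   remains: the increment is 0 there, and monotonicity makes the gain at [S] nonnegative. *)
have [xT|xT] := boolP (x \in T); last by rewrite g_sub // subsetUl.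
rewrite (setUidPr _) ?sub1set // subrr subr_ge0.
by rewrite g_mono // subsetUr.
Qed.

End SubmodularGains.

Section DistortedGreedy.
Variables (R : realType) (U : finType) (g : {set U} -> R) (c : U -> R).
Variables (kappa t : nat) (sel : nat -> {ffun U -> R} -> U).
Implicit Types (S X : {set U}) (m i : nat).

Local Notation O := (value_oracle g c).
Local Notation a := (1 - kappa%:R^-1 : R).
Local Notation loop := (distorted_bi_loop kappa t sel).

Definition gains i S := (exec O (query_gains R kappa t i S)).1.

Definition round i S :=
  if 0 < gains i S (sel i (gains i S)) then sel i (gains i S) |: S else S.

Lemma gainsE i S x :
  gains i S x = Phi kappa t i (O (x |: S)) - Phi kappa t i (O S).
Proof. by rewrite /gains exec_tabulate mem_enum. Qed.

Lemma exec_loopS m i S :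
  exec O (loop m.+1 i S) =
  ((exec O (loop m i.+1 (round i S))).1,
   (#|U| * 2 + (exec O (loop m i.+1 (round i S))).2)%N).
Proof.
rewrite /= exec_bind; congr (_, (_ + _)%N).
(* Each gain costs two queries, one at [x |: S] and one at [S]. *)
by rewrite (@exec_tabulate_queries _ _ _ _ 2) // cardE.
Qed.

Lemma exec_loop_queries m i S : (exec O (loop m i S)).2 = (m * (#|U| * 2))%N.
Proof. by elim: m i S => // m IH i S; rewrite exec_loopS /= IH. Qed.

Lemma card_loop m i S : (#|(exec O (loop m i S)).1| <= m + #|S|)%N.
Proof.
elim: m i S => // m IH i S; rewrite exec_loopS /=.
apply: leq_trans (IH _ _) _; rewrite addSnnS leq_add2l /round.
by case: ifP => // _; rewrite cardsU1; case: (_ \notin _).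
Qed.

Hypotheses (g_mono : monotone_setfun g) (g_sub : submodular g).
Hypotheses (c_ge0 : forall x, 0 <= c x) (kappa_gt0 : (0 < kappa)%N).
Hypothesis sel_max : argmax_rule sel.

Lemma distortion_ge0 : 0 <= a.
Proof. by rewrite subr_ge0 invf_le1 ?ler1n ?ltr0n. Qed.

Lemma round_gain i S X : (#|X| <= kappa)%N ->
  (a ^+ (t - i) * (g X - g S) - modular_cost c X) / kappa%:R <=
  Phi kappa t i (O (round i S)) - Phi kappa t i (O S).
Proof.
move=> Xk; set D := _ - Phi _ _ _ _.
(* [D] is the best gain if that is positive and 0 otherwise. Its sign matters because [X] may have
   fewer than [kappa] elements: it gives [#|X| * D <= kappa * D]. *)
have [D_ge0 D_max] : 0 <= D /\ forall x, gains i S x <= D.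
  rewrite /D /round; case: ltP => [d_gt0|d_le0].
    by rewrite -gainsE; split=> [|x]; [exact: ltW | exact: sel_max].
  by rewrite subrr; split=> // x; apply: le_trans d_le0; exact: sel_max.
rewrite ler_pdivrMr ?ltr0n //.
apply: le_trans (_ : \sum_(x in X) D <= _); last first.
  by rewrite sumr_const -[leLHS]mulr_natr ler_wpM2l ?ler_nat.
apply: le_trans (_ : \sum_(x in X) (a ^+ (t - i) * (g (x |: S) - g S) - c x) <= _).
  rewrite sumrB -mulr_sumr lerB // ler_wpM2l ?exprn_ge0 ?distortion_ge0 //.
  exact: submodular_sum_gains.
apply: ler_sum => x _; apply: le_trans (D_max x); rewrite gainsE /Phi /=.
have := modular_cost_setU1 _ _ c S x (c_ge0 x); lra.
Qed.

(** Generalized to any starting set and [m] remaining rounds so that induction applies. The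
    constraint on [i + m] makes round [i] use the weight [a ^+ m.-1] when [0 < m], so [a ^+ m] is
    the weight just before it. *)
Lemma loop_value m i S X : (#|X| <= kappa)%N -> (i + m = t.+1)%N ->
  a ^+ m * g S - modular_cost c S
    + ((1 - a ^+ m) * g X - m%:R / kappa%:R * modular_cost c X) <=
  g (exec O (loop m i S)).1 - modular_cost c (exec O (loop m i S)).1.
Proof.
move=> Xk; elim: m i S => [|m IH] i S im; first by rewrite /= expr0; lra.
rewrite exec_loopS /=; apply: le_trans (IH _ _ _); last by rewrite addSnnS.
have := round_gain i S X Xk; rewrite /Phi /=.
have -> : (t - i = m)%N by move: im; rewrite addnS => -[<-]; rewrite addKn.
(* The change of weight enters as [a * a ^+ m = a ^+ m - a ^+ m / kappa]; its [g S] part cancels the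
   [- g S] term of [round_gain]. *)
by rewrite exprS -natr1; lra.
Qed.

End DistortedGreedy.

(** This is [1 + x <= expR x] at [x = - 1/k], raised to the power [t]; both bases are
    nonnegative. *)
Lemma onem_inv_expn_le_expR (R : realType) (k t : nat) : (0 < k)%N ->
  (1 - k%:R^-1) ^+ t <= expR (- (t%:R / k%:R)) :> R.
Proof.
move=> k_gt0; rewrite -mulrN expRM_natl lerXn2r ?nnegrE ?expR_ge0 //.
  exact: distortion_ge0.
exact: expR_ge1Dx.
Qed.

Theorem theorem6 (R : realType) :
  exists C : R,
  forall (U : finType) (g : {set U} -> R) (c : U -> R) (kappa t : nat) (eps : R)
         (sel : nat -> {ffun U -> R} -> U),
    (forall X : {set U}, 0 <= g X) ->
    monotone_setfun g ->
    submodular g ->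
    (forall x : U, 0 <= c x) ->
    (0 < kappa)%N ->
    0 < eps -> eps < 1 ->
    t%:R = ln (1 / eps) * kappa%:R ->
    argmax_rule sel ->
    let: (T, queries) :=
      exec (value_oracle g c) (distorted_bi kappa t sel) in
    [/\ queries%:R <= C * (#|U|%:R * kappa%:R * ln (1 / eps)),
        #|T|%:R <= ln (1 / eps) * kappa%:R
      & forall X : {set U}, (#|X| <= kappa)%N ->
          g T - modular_cost c T
            >= (1 - eps) * g X - ln (1 / eps) * modular_cost c X].
Proof.
(* The query count is exactly [2 * #|U| * t], with [t = ln (1 / eps) * kappa]. *)
exists 2 => U g c kappa t eps sel g_ge0 g_mono g_sub c_ge0 k_gt0 eps_gt0 _ tE selP.
have := exec_loop_queries _ _ g c kappa t sel t 1 set0.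
have := card_loop _ _ g c kappa t sel t 1 set0.
have := @loop_value _ _ _ _ _ t _ g_mono g_sub c_ge0 k_gt0 selP t 1 set0.
rewrite -/(distorted_bi kappa t sel).
case: (exec _ _) => T q /= value; rewrite cards0 addn0 => cardT ->.
split=> [||X Xk].
- by rewrite !natrM tE; lra.
- by rewrite -tE ler_nat.
have k_neq0 : kappa%:R != 0 :> R by rewrite pnatr_eq0 -lt0n.
have tkE : t%:R / kappa%:R = ln (1 / eps) by rewrite tE mulfK.
apply: le_trans (value X Xk (add1n t)).
rewrite tkE [modular_cost c set0]big_set0 subr0.
have a_le_eps : (1 - kappa%:R^-1) ^+ t <= eps.
  apply: le_trans (onem_inv_expn_le_expR R kappa t k_gt0) _.
  by rewrite tkE div1r lnV ?posrE // opprK lnK ?posrE.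
have a_ge0 : 0 <= (1 - kappa%:R^-1 : R) ^+ t by rewrite exprn_ge0 ?distortion_ge0.
have := mulr_ge0 a_ge0 (g_ge0 set0).
have := ler_wpM2r (g_ge0 X) a_le_eps.
by lra.
Qed.
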